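(* Let $d=d_\delta$ be a bounded rotation-invariant distance on $\mathcal{S}^{q-1}$, with $d_\delta(\theta,\psi)=\delta(\theta'\psi)$ for some function $\delta:[-1,1]\to\mathbb{R}^+$, and let $H$ be a probability distribution on $\mathcal{S}^{q-1}$. Then the depth $D_{d_\delta}$ is rotation-invariant, in the sense that for every $q\times q$ orthogonal matrix $O$ and every $\theta\in\mathcal{S}^{q-1}$, $$D_{d_\delta}(O\theta,H_O)=D_{d_\delta}(\theta,H),$$ where $H_O$ denotes the image of $H$ under the transformation $x\mapsto Ox$, that is, $H_O$ is the distribution of $OW$ when $W$ has distribution $H$.
   Context: Let $q\ge 2$ and $\mathcal{S}^{q-1}=\{x\in\mathbb{R}^q: x'x=1\}$, where $'$ denotes transpose; $\mathbb{R}^+=[0,\infty)$. A distance $d$ on $\mathcal{S}^{q-1}$ is a metric on this set; it is rotation-invariant if $d(O\theta,O\psi)=d(\theta,\psi)$ for all $\theta,\psi\in\mathcal{S}^{q-1}$ and all $q\times q$ orthogonal matrices $O$. Any rotation-invariant distance is of the form $d_\delta(\theta,\psi)=\delta(\theta'\psi)$ for some $\delta:[-1,1]\to\mathbb{R}^+$. For a bounded distance $d$ put $d^{\rm sup}=\sup\{d(\theta,\psi):\theta,\psi\in\mathcal{S}^{q-1}\}$. For a (Borel probability) distribution $H$ on $\mathcal{S}^{q-1}$, the directional $d$-depth of $\theta\in\mathcal{S}^{q-1}$ with respect to $H$ is $D_d(\theta,H)=d^{\rm sup}-E_H[d(\theta,W)]$, where $E_H$ is expectation when $W$ has distribution $H$;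 it is understood that $w\mapsto d(\theta,w)$ is Borel measurable for every $\theta$, so that this expectation makes sense. *)

(* Defs.v *)
From HB Require Import structures.
From mathcomp Require Import all_boot all_order all_algebra.
From mathcomp Require Import all_classical all_reals all_analysis.

Set Implicit Arguments.
Unset Strict Implicit.
Unset Printing Implicit Defensive.

Import Order.TTheory GRing.Theory Num.Theory.
Import numFieldNormedType.Exports.

Local Open Scope classical_set_scope.
Local Open Scope ring_scope.

Definition dotv (R : realType) (q : nat) (x y : 'cV[R]_q) : R :=
  (x^T *m y) 0 0.

Definition sphere_set (R : realType) (q : nat) : set 'cV[R]_q :=
  [set x | dotv x x = 1].

(* The proof of [1 < q] only serves to make the type pointed, as every
   [measurableType] must be. *)
Definition sphere (R : realType) (q : nat) (hq : (1 < q)%N) : Type :=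
  set_type (@sphere_set R q).

Section sphere_structures.
Variables (R : realType) (q : nat) (hq : (1 < q)%N).

Lemma sphere_base_subproof :
  (\col_(i < q) (i == Ordinal (ltnW hq))%:R : 'cV[R]_q) \in @sphere_set R q.
Proof.
rewrite inE /sphere_set /= /dotv mxE (bigD1 (Ordinal (ltnW hq))) //= big1.
  by rewrite !mxE eqxx mulr1 addr0.
by move=> i /negbTE ni; rewrite !mxE ni mul0r.
Qed.

HB.instance Definition _ :=
  Topological.copy (sphere R hq) (set_type (@sphere_set R q)).
HB.instance Definition _ :=
  isPointed.Build (sphere R hq) (SigSub sphere_base_subproof).

(* Borel sigma-algebra of the subspace topology inherited from R^q *)
HB.instance Definition _ := Measurable.copy (sphere R hq)
  (g_sigma_algebraType (@open (sphere R hq))).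

End sphere_structures.

Definition orthogonal_mx (R : realType) (q : nat) (O : 'M[R]_q) : Prop :=
  O^T *m O = 1%:M.

Section rotation.
Variables (R : realType) (q : nat) (hq : (1 < q)%N).
Variables (O : 'M[R]_q) (hO : orthogonal_mx O).

Lemma rotate_subproof (x : sphere R hq) : O *m \val x \in @sphere_set R q.
Proof.
have x1 : dotv (\val x) (\val x) = 1 by exact: set_valP x.
rewrite inE /sphere_set /= -[RHS]x1 /dotv.
by rewrite trmx_mul mulmxA -(mulmxA _ O^T) hO mulmx1.
Qed.

Definition rotate (x : sphere R hq) : sphere R hq :=
  SigSub (rotate_subproof x).

Lemma continuous_mulmx : continuous (fun x : 'cV[R]_q => O *m x).
Proof.
have coord i j : continuous (fun x : 'cV[R]_q => (O *m x) i j).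
  have -> : (fun x : 'cV[R]_q => (O *m x) i j) =
      (fun x => \sum_(k < q) O i k * x k j) by apply/funext => x; rewrite mxE.
  apply: continuous_big => [|k _ x]; first exact: add_continuous.
  by apply: (@cvgM _ _ (nbhs x)); [exact: cvg_cst | exact: coord_continuous].
move=> x A [P xP PA]; have nx : Filter (nbhs x) by exact: nbhs_filter.
have : \forall y \near x, forall i j, P i j ((O *m y) i j).
  apply: (@filter_forall _ _ _ _ nx) => i.
  by apply: (@filter_forall _ _ _ _ nx) => j; exact: (coord i j x _ (xP i j)).
by apply: (@filterS _ _ nx) => y Py; exact: PA.
Qed.

Lemma continuous_rotate : continuous rotate.
Proof.
apply: continuous_comp_initial => x.
apply: (@continuous_comp _ _ _ (set_val : sphere R hq -> 'cV[R]_q)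
  (fun x : 'cV[R]_q => O *m x)).
  exact: initial_continuous.
exact: continuous_mulmx.
Qed.

Lemma measurable_rotate : measurable_fun setT rotate.
Proof.
apply: (@measurability _ _ _ _ _ _ (@open (sphere R hq))) => //.
move=> _ [U oU <-]; rewrite setTI; apply: sub_sigma_algebra.
by apply: open_comp => // x _; exact: continuous_rotate.
Qed.

HB.instance Definition _ := isMeasurableFun.Build _ _ _ _ rotate
  measurable_rotate.

End rotation.

Section depth.
Variables (R : realType) (q : nat) (hq : (1 < q)%N).
Implicit Type d : sphere R hq -> sphere R hq -> R.

Definition is_distance d : Prop :=
  [/\ forall x y, 0 <= d x y,
      forall x y, d x y = 0 <-> x = y,
      forall x y, d x y = d y x &
      forall x y z, d x z <= d x y + d y z].

Definition bounded_distance d : Prop := exists M : R, forall x y, d x y <= M.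

Definition rotation_invariant d : Prop :=
  forall (O : 'M[R]_q) (hO : orthogonal_mx O) (x y : sphere R hq),
    d (rotate hO x) (rotate hO y) = d x y.

(* [delta] stands for a function on [-1, 1], which contains every inner product
   of two points of the sphere; its values elsewhere are irrelevant. *)
Definition dist_of (delta : R -> R) (x y : sphere R hq) : R :=
  delta (dotv (\val x) (\val y)).

Definition dsup d : R := sup [set r | exists x y, r = d x y].

(* Extended-real because the library's expectation is; for a bounded measurable
   distance the value is finite. *)
Definition depth d (x : sphere R hq) (H : probability (sphere R hq) R)
    : \bar R :=
  ((dsup d)%:E - 'E_H[d x])%E.

End depth.

(* Main.v *)
Require Import Defs.
From mathcomp Require Import all_boot all_order all_algebra.
From mathcomp Require Import all_classical all_reals all_analysis.
Import Order.TTheory GRing.Theory Num.Theory.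
Import numFieldNormedType.Exports.
Local Open Scope classical_set_scope.
Local Open Scope ring_scope.

(** The constant [dsup] involves neither the point nor the distribution, so
    only the expectation has to be compared.  Change of variables
    ([expectation_distribution_ge0]) turns the expectation of [d (O theta) _]
    under the image distribution into the expectation of
    [w |-> d (O theta) (O w)] under the original one, and rotation invariance
    of [d] identifies this integrand with [d theta _]. *)

(** Nonnegativity is what gives the change of variables its meaning: both sides
    are then well defined in the extended reals, and may equal [+oo]. *)
Lemma expectation_distribution_ge0 d d' (T : measurableType d)
    (T' : measurableType d') (R : realType) (P : probability T R)
    (f : {mfun T >-> T'}) (X : T' -> R) :
  measurable_fun setT X -> (forall y, 0 <= X y) ->
  ('E_(distribution P f)[X] = 'E_P[X \o f])%E.
Proof.
move=> mX X0; rewrite unlock /distribution ge0_integral_pushforward//.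
- exact/measurable_realfun.measurable_EFinP.
- by move=> y _; rewrite lee_fin.
Qed.

Theorem theorem1 (R : realType) (q : nat) (hq : (1 < q)%N) (delta : R -> R)
  (delta_ge0 : forall t : R, -1 <= t <= 1 -> 0 <= delta t)
  (d_dist : is_distance (@dist_of R q hq delta))
  (d_bounded : bounded_distance (@dist_of R q hq delta))
  (d_rot : rotation_invariant (@dist_of R q hq delta))
  (d_meas : forall theta : sphere R hq,
     measurable_fun setT (dist_of delta theta))
  (H : probability (sphere R hq) R)
  (O : 'M[R]_q) (hO : orthogonal_mx O) (theta : sphere R hq) :
  depth (dist_of delta) (rotate hO theta) (distribution H (rotate hO)) =
  depth (dist_of delta) theta H.
Proof.
have [d_ge0 _ _ _] := d_dist.
rewrite /depth expectation_distribution_ge0//.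
by congr (_ - 'E_H[_])%E; apply/funext => w; exact: d_rot.
Qed.
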